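(* The class $\mathbf{TP}$ of typical reals is incomparable, with respect to inclusion, with each of the classes $\mathbf{ML}$, $\mathbf{SR}$ and $\mathbf{CR}$ of Martin-Löf random, Schnorr random and computably random reals, respectively. That is, for each $\mathbf{C}\in\{\mathbf{ML},\mathbf{SR},\mathbf{CR}\}$, $\mathbf{TP}\not\subseteq\mathbf{C}$ and $\mathbf{C}\not\subseteq\mathbf{TP}$.
   Context: Reals are subsets of $\omega$, identified with their characteristic functions in $2^\omega$. $\mathcal{R}=(\omega,\mathcal{P}(\omega),+,\cdot,<,\in,0,1)$ is the full standard model of second-order arithmetic, in the two-sorted language $L_2=\{+,\cdot,<,\in,0,1\}$. A real $a$ is typical, $a\in\mathbf{TP}$, if for every $L_2$-formula $\phi(x)$ without parameters ($x$ ranging over reals) such that $\mathcal{R}\models\phi(a)$, $|\{x\in\mathcal{P}(\omega):\mathcal{R}\models\phi(x)\}|=2^{\aleph_0}$. Let $\mu$ be the uniform (fair-coin) measure on $2^\omega$, with $\mu([\sigma])=2^{-|\sigma|}$ for $[\sigma]=\{x\in 2^\omega:\sigma\subset x\}$, $\sigma\in 2^{<\omega}$. A Martin-Löf test is a computable sequence $(V_n)_n$ of r.e. open sets (i.e. uniformly r.e. unions of sets $[\sigma]$) with $\mu(V_n)\leq 2^{-n}$ for all $n$; a real $a$ is Martin-Löf random if $a\notin\bigcap_n V_n$ for every Martin-Löf test. A Schnorr test is a Martin-Löf test $(V_n)_n$ for which there is a computable strictly increasing $g:\omega\to\omega$ with $\mu(V_n)=2^{-g(n)}$ for all $n$; a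 real $a$ is Schnorr random if $a\notin\bigcap_n V_n$ for every Schnorr test. A real $a$ is computably random if no computable martingale $d:2^{<\omega}\to\mathbb{R}_{\geq 0}$ (a function with $2d(\sigma)=d(\sigma0)+d(\sigma1)$ for all $\sigma$) succeeds on $a$, i.e. for no such $d$ is $\limsup_n d(a\upharpoonright n)=\infty$. *)

(* Defs.v *)
From HB Require Import structures.
From mathcomp Require Import all_boot all_order all_algebra.
From mathcomp Require Import all_classical all_reals all_analysis.
From mathcomp Require Import zify lra.

Set Implicit Arguments.
Unset Strict Implicit.
Unset Printing Implicit Defensive.

Import Order.TTheory GRing.Theory Num.Theory.
Import numFieldNormedType.Exports.

Local Open Scope classical_set_scope.
Local Open Scope card_scope.
Local Open Scope ring_scope.

Definition real := nat -> bool.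

Definition restrict (x : real) (n : nat) : seq bool := mkseq x n.

Definition cylinder (s : seq bool) : set real :=
  [set x | restrict x (size s) = s].

(* Bound variables are de Bruijn indices, one series for each sort.  Number
   equality is a logical symbol; equality of sets is definable from it. *)
Inductive term :=
  | t_var of nat
  | t_zero
  | t_one
  | t_add of term & term
  | t_mul of term & term.

Inductive formula :=
  | f_eq of term & term
  | f_lt of term & term
  | f_in of term & nat
  | f_not of formula
  | f_and of formula & formula
  | f_exN of formula
  | f_exS of formula.

Fixpoint term_wf (n : nat) (t : term) : bool :=
  match t with
  | t_var i => (i < n)%N
  | t_zero | t_one => true
  | t_add t1 t2 | t_mul t1 t2 => term_wf n t1 && term_wf n t2
  end.

(* The free number (resp. set) variables of f have index < n (resp. < m). *)
Fixpoint formula_wf (n m : nat) (f : formula) : bool :=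
  match f with
  | f_eq t1 t2 | f_lt t1 t2 => term_wf n t1 && term_wf n t2
  | f_in t i => term_wf n t && (i < m)%N
  | f_not f1 => formula_wf n m f1
  | f_and f1 f2 => formula_wf n m f1 && formula_wf n m f2
  | f_exN f1 => formula_wf n.+1 m f1
  | f_exS f1 => formula_wf n m.+1 f1
  end.

Fixpoint term_val (e : seq nat) (t : term) : nat :=
  match t with
  | t_var i => nth 0%N e i
  | t_zero => 0%N
  | t_one => 1%N
  | t_add t1 t2 => (term_val e t1 + term_val e t2)%N
  | t_mul t1 t2 => (term_val e t1 * term_val e t2)%N
  end.

(* Satisfaction in the full standard model.  The default values of [nth] are
   irrelevant for [formula_wf (size e) (size E)] formulas. *)
Fixpoint sat (e : seq nat) (E : seq real) (f : formula) : Prop :=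
  match f with
  | f_eq t1 t2 => term_val e t1 = term_val e t2
  | f_lt t1 t2 => (term_val e t1 < term_val e t2)%N
  | f_in t i => nth (fun _ => false) E i (term_val e t)
  | f_not f1 => ~ sat e E f1
  | f_and f1 f2 => sat e E f1 /\ sat e E f2
  | f_exN f1 => exists k : nat, sat (k :: e) E f1
  | f_exS f1 => exists X : real, sat e (X :: E) f1
  end.

Definition defined_class (phi : formula) : set real :=
  [set x | sat [::] [:: x] phi].

Definition typical : set real :=
  [set a | forall phi : formula, formula_wf 0 1 phi ->
    defined_class phi a -> defined_class phi #= [set: nat -> bool]].

Inductive recfun :=
  | r_zero
  | r_succ
  | r_proj of nat
  | r_comp of recfun & seq recfun
  | r_prec of recfun & recfun
  | r_mu of recfun.

Definition all2P (A B : Type) (P : A -> B -> Prop) :=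
  fix loop (s : seq A) (t : seq B) : Prop :=
    match s, t with
    | [::], [::] => True
    | a :: s', b :: t' => P a b /\ loop s' t'
    | _, _ => False
    end.

(* [rec_eval c xs y]: the partial recursive function with program c, on
   arguments xs, is defined with value y.  Arities are implicit: absent
   arguments read as 0 and extra ones are ignored.  The recursion variable of
   [r_prec] and the searched variable of [r_mu] come first. *)
Fixpoint rec_eval (c : recfun) (xs : seq nat) (y : nat) {struct c} : Prop :=
  match c with
  | r_zero => y = 0%N
  | r_succ => y = (head 0%N xs).+1
  | r_proj i => y = nth 0%N xs i
  | r_comp f gs => exists ys : seq nat,
      all2P (fun g z => rec_eval g xs z) gs ys /\ rec_eval f ys y
  | r_prec f g =>
      (fix prec (n z : nat) {struct n} : Prop :=
         match n with
         | 0 => rec_eval f (behead xs) z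
         | n'.+1 => exists u : nat,
             prec n' u /\ rec_eval g [:: n', u & behead xs] z
         end) (head 0%N xs) y
  | r_mu f => rec_eval f (y :: xs) 0%N /\
      forall n, (n < y)%N -> exists z : nat, rec_eval f (n :: xs) z.+1
  end.

Definition computable1 (f : nat -> nat) :=
  exists c : recfun, forall n, rec_eval c [:: n] (f n).

Definition computable2 (f : nat -> nat -> nat) :=
  exists c : recfun, forall m n, rec_eval c [:: m; n] (f m n).

Definition re2 (W : nat -> nat -> Prop) :=
  exists c : recfun, forall m n, W m n <-> exists y, rec_eval c [:: m; n] y.

(* Bijective base-2 numeration, a bijection from binary strings onto nat. *)
Definition strcode (s : seq bool) : nat :=
  foldl (fun (k : nat) (b : bool) => (k.*2 + b.+1)%N) 0%N s.

Definition re_open_seq (V : nat -> set real) :=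
  exists2 W : nat -> nat -> Prop, re2 W &
    forall n, V n = \bigcup_(s in [set s | W n (strcode s)]) cylinder s.

(* The values d(s) are computable reals, uniformly in s: the rational
   (p - q) / (r + 1) approximates d(s) within 2^-n. *)
Definition computable_real_fun (R : realType) (d : seq bool -> R) :=
  exists p q r : nat -> nat -> nat,
    [/\ computable2 p, computable2 q, computable2 r &
        forall (s : seq bool) (n : nat), let k := strcode s in
          `|d s - ((p k n)%:R - (q k n)%:R) / (r k n).+1%:R| <= 2 ^- n].

Definition cantor := g_sigma_algebraType (range cylinder).

HB.instance Definition _ := Measurable.on cantor.

Definition digits (R : realType) (x : R) : cantor :=
  fun n => odd (Num.truncn (2 ^+ n.+1 * x)).

(* The distribution of the binary digits of a uniform point of [0, 1[ . *)
Definition coin (R : realType) : set cantor -> \bar R :=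
  pushforward
    (mrestr (@lebesgue_measure R) (measurable_itv `[(0 : R), 1[)) (@digits R).

Section coin_measure.
Variable R : realType.

Let measurable_truncn_eq (c : R) (k : nat) : 0 < c ->
  measurable [set x : R | Num.truncn (c * x) = k].
Proof.
move=> c0.
have mle n : measurable [set x : R | (Num.truncn (c * x) <= n)%N].
  rewrite [X in measurable X](_ : _ = `]-oo, (n.+1%:R / c)[%classic).
    exact: measurable_itv.
  apply/seteqP; split => x /=; rewrite in_itv/= truncn_le_nat;
    by rewrite ltr_pdivlMr// mulrC.
case: k => [|k].
  rewrite [X in measurable X](_ : _ = [set x | (Num.truncn (c * x) <= 0)%N])//.
  by apply/seteqP; split => x /=; rewrite leqn0 => /eqP.
rewrite [X in measurable X](_ : _ = [set x | (Num.truncn (c * x) <= k.+1)%N]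
    `\` [set x | (Num.truncn (c * x) <= k)%N]); first exact: measurableD.
apply/seteqP; split => x /=.
  by move=> ->; rewrite ltnn; split.
by move=> [h1 /negP]; rewrite -ltnNge => h2; apply/eqP; rewrite eqn_leq h1 h2.
Qed.

Let measurable_digit (n : nat) (b : bool) :
  measurable [set x : R | digits x n = b].
Proof.
rewrite [X in measurable X](_ : _ =
    \bigcup_(k in [set k | odd k = b])
      [set x : R | Num.truncn (2 ^+ n.+1 * x) = k]); last first.
  apply/seteqP; split => x /=.
    by move=> <-; exists (Num.truncn (2 ^+ n.+1 * x)).
  by move=> [k /= <- <-].
apply: bigcup_measurable => k _; apply: measurable_truncn_eq.
by rewrite exprn_gt0.
Qed.

Lemma cylinder_rcons (s : seq bool) (b : bool) :
  cylinder (rcons s b) = cylinder s `&` [set x | x (size s) = b].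
Proof.
apply/seteqP; split => x; rewrite /cylinder /restrict /= size_rcons mkseqS.
  by move=> /eqP; rewrite eqseq_rcons => /andP[/eqP -> /eqP ->].
by move=> [-> ->].
Qed.

Lemma measurable_digits : measurable_fun [set: R] (@digits R).
Proof.
apply: (@measurability _ _ R cantor setT (@digits R) (range cylinder)) => //.
move=> _ [_ [s _ <-] <-]; rewrite setTI.
elim/last_ind: s => [|s b IH].
  by rewrite [X in measurable X](_ : _ = setT)//; apply/seteqP; split.
rewrite cylinder_rcons preimage_setI; apply: measurableI => //.
exact: measurable_digit.
Qed.

Let coin0 : coin R set0 = 0%E.
Proof. by rewrite /coin /pushforward /mrestr preimage_set0 set0I measure0. Qed.

Let coin_ge0 A : (0 <= coin R A)%E.
Proof. by rewrite /coin /pushforward /mrestr; exact: measure_ge0. Qed.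

Let coin_sigma_additive : semi_sigma_additive (@coin R).
Proof.
move=> F mF tF mUF; rewrite /coin /pushforward preimage_bigcup.
have md A : measurable A -> measurable (@digits R @^-1` A).
  by move=> mA; rewrite -[X in measurable X]setTI; exact: measurable_digits.
apply: (@measure_semi_sigma_additive _ _ _ (mrestr (@lebesgue_measure R)
    (measurable_itv `[(0 : R), 1[))).
- by move=> n; exact: md.
- apply/trivIsetP => /= i j _ _ ij; rewrite -preimage_setI.
  by move/trivIsetP : tF => /(_ _ _ _ _ ij) ->//; rewrite preimage_set0.
- by rewrite -preimage_bigcup; exact: md.
Qed.

HB.instance Definition _ := isMeasure.Build _ _ _ (@coin R)
  coin0 coin_ge0 coin_sigma_additive.

Let binval (s : seq bool) : nat :=
  foldl (fun (k : nat) (b : bool) => (k.*2 + b)%N) 0%N s.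

Let binval_rcons s b : binval (rcons s b) = ((binval s).*2 + b)%N.
Proof. by rewrite /binval foldl_rcons. Qed.

Let binval_inj s t : size s = size t -> binval s = binval t -> s = t.
Proof.
elim/last_ind: s t => [|s b IH] t; first by case: t.
case/lastP: t => [|t c]; rewrite !size_rcons// => -[st].
rewrite !binval_rcons => h.
have bc : b = c.
  by have := congr1 odd h; rewrite !oddD !odd_double/=; case: b c {h} => [] [].
rewrite bc; congr rcons; apply: IH => //.
by move: h; rewrite bc => /addIn /double_inj.
Qed.

Let binval_lt s : (binval s < 2 ^ size s)%N.
Proof.
elim/last_ind: s => [//|s b IH].
rewrite binval_rcons size_rcons expnS mul2n.
by rewrite -(ltn_pmul2l (isT : 0 < 2)%N) in IH; case: b; lia.
Qed.

Let binval_digits (x : R) n : 0 <= x ->  x < 1 ->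
  binval (restrict (digits x) n) = Num.truncn (2 ^+ n * x).
Proof.
move=> x0 x1; elim: n => [|n IH].
  rewrite expr0 mul1r; apply/esym/eqP.
  by rewrite truncn_eq// x0.
rewrite /restrict mkseqS binval_rcons IH /digits.
set y := 2 ^+ n * x.
have y0 : 0 <= y by rewrite mulr_ge0// exprn_ge0.
have -> : 2 ^+ n.+1 * x = 2 * y by rewrite exprS mulrA.
have y20 : 0 <= 2 * y by rewrite mulr_ge0.
have /andP[h1 h2] := truncn_itv y20.
rewrite -[RHS]odd_double_half addnC; congr (_ + _.*2)%N.
apply: truncn_def; move: h1 h2.
rewrite -{1 2}[Num.truncn (2 * y)]odd_double_half.
move: (odd _) (_./2) => b k.
rewrite -!natr1 natrD -muln2 natrM.
by case: b => /= h1 h2; apply/andP; split; lra.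
Qed.

Lemma coin_cylinder (s : seq bool) :
  coin R (cylinder s) = (2 ^- size s)%:E.
Proof.
have p0 : 0 < 2 ^+ size s :> R by rewrite exprn_gt0.
rewrite /coin /pushforward /mrestr.
set k : R := (binval s)%:R.
rewrite [X in lebesgue_measure X](_ : _ =
    `[k / 2 ^+ size s, (k + 1) / 2 ^+ size s[%classic); last first.
  apply/seteqP; split => x /=; rewrite !in_itv/=.
    move=> [xs /andP[x0 x1]]; have := binval_digits (size s) x0 x1.
    rewrite [restrict _ _]xs => /esym h.
    have /truncn_itv : 0 <= 2 ^+ size s * x by rewrite mulr_ge0// ltW.
    rewrite h -[(binval s).+1%:R]natr1 [_ * x]mulrC => /andP[kx xk].
    by rewrite ler_pdivrMr// ltr_pdivlMr// kx xk.
  rewrite ler_pdivrMr// ltr_pdivlMr// => /andP[xk kx].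
  have x0 : 0 <= x.
    by rewrite -(pmulr_rge0 _ p0) mulrC; apply: le_trans xk; exact: ler0n.
  have x1 : x < 1.
    rewrite -(ltr_pM2r p0) mul1r; apply: lt_le_trans kx _.
    by rewrite natr1 -natrX ler_nat binval_lt.
  split; last by rewrite x0 x1.
  apply: binval_inj; first by rewrite size_mkseq.
  rewrite binval_digits//; apply: truncn_def.
  by rewrite -[(binval s).+1%:R]natr1 mulrC xk kx.
rewrite lebesgue_measure_itv/= lte_fin ltr_pM2r ?invr_gt0// ltrDl ltr01.
by rewrite -EFinB -mulrBl addrAC subrr add0r mul1r.
Qed.

Let coin_setT : coin R [set: cantor] = 1%E.
Proof.
rewrite (_ : [set: cantor] = cylinder [::]); last by apply/seteqP; split.
by rewrite coin_cylinder expr0 invr1.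
Qed.

HB.instance Definition _ :=
  Measure_isProbability.Build _ _ _ (@coin R) coin_setT.

End coin_measure.

Section randomness.
Variable R : realType.

Definition ml_test (V : nat -> set real) :=
  re_open_seq V /\ forall n, (coin R (V n) <= (2 ^- n)%:E)%E.

Definition schnorr_test (V : nat -> set real) :=
  ml_test V /\
  exists g : nat -> nat, [/\ computable1 g, {homo g : m n / (m < n)%N} &
    forall n, coin R (V n) = (2 ^- g n)%:E].

Definition martingale (d : seq bool -> R) :=
  (forall s, 0 <= d s) /\
  forall s, 2 * d s = d (rcons s false) + d (rcons s true).

Definition succeeds (d : seq bool -> R) (a : real) :=
  limn_esup (fun n => (d (restrict a n))%:E) = +oo%E.

Definition ml_random : set real :=
  [set a | forall V, ml_test V -> ~ (\bigcap_n V n) a].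

Definition schnorr_random : set real :=
  [set a | forall V, schnorr_test V -> ~ (\bigcap_n V n) a].

Definition computably_random : set real :=
  [set a | forall d, martingale d -> computable_real_fun d -> ~ succeeds d a].

End randomness.

Definition incomparable (A B : set real) := ~ A `<=` B /\ ~ B `<=` A.

(* Main.v *)
From HB Require Import structures.
From mathcomp Require Import all_boot all_order all_algebra.
From mathcomp Require Import all_classical all_reals all_analysis.
From mathcomp Require Import zify lra.
Require Import Defs.

(** Two reals suffice.  Every Martin-Loef random real is Schnorr random and
    computably random, so the six non-inclusions follow from a typical real that
    is neither Schnorr random nor computably random, and from a Martin-Loef
    random real that is not typical.

    A typical real that is not random.  The reals vanishing at all even places
    form a null set in the most effective way: betting everything on the even
    places gives a computable martingale [bet] with values 0 or powers of 2,
    which succeeds on all of them, and the sets where [bet] reaches [2 ^ n] are a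
    Schnorr test with measures exactly [2 ^- n].  Yet they cannot all fail to be
    typical.  The non-typical reals are covered by countably many definable
    classes of size less than the continuum, and Koenig's diagonal argument
    ([typical_even_zero]) finds a real that avoids all of these classes while
    having only its odd places at its disposal.

    A random real that is not typical.  It is enough to define a single
    Martin-Loef random real by a formula, since its singleton is then a small
    definable class.  Take program number [e], run it on the pairs [e + 2, k], and
    let it enumerate an open set [V_e]; discard [e] if [V_e] has measure above
    [2 ^- (e + 2)].  The remaining [V_e] have a union of measure at most 1/2, which
    contains a member of every Martin-Loef test.  The complement of the union is
    closed and nonempty, so it has a lexicographically least element, and this
    real is defined by its minimality as soon as the union is definable.

    Definability of the union rests on two formulas.  Halting computations are
    definable because evaluation is the least relation closed under the clauses
    of the semantics of programs, and leastness is expressed with one quantifier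
    over sets ([eval]).  The measure bound is definable without any real
    arithmetic: an open set has measure at most [2 ^- n] iff at every level
    [L >= n] the strings of length [L] that it covers inject into those that begin
    with [n] zeros ([thinP]).

    That Martin-Loef randomness implies computable randomness is Ville's
    inequality ([ville]): the set where a martingale exceeds [c] times its initial
    value has measure at most [1 / c], and it is effectively open because an
    approximation of the martingale within 1 is enough to enumerate it. *)

Set Implicit Arguments.
Unset Strict Implicit.
Unset Printing Implicit Defensive.

Import Order.TTheory GRing.Theory Num.Theory.

Local Open Scope classical_set_scope.
Local Open Scope nat_scope.

(** * Definable predicates *)

(** An injective pairing which is itself a term of the language, so that
    relations on numbers can be coded as sets without arithmetization. *)
Definition npair (a b : nat) : nat := (a + b) * (a + b) + a.

Lemma npair_inj a b c d : npair a b = npair c d -> a = c /\ b = d.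
Proof.
rewrite /npair => h.
have [lt|lt|eq] := ltngtP (a + b) (c + d); [nia|nia|].
by move: h; rewrite eq => /addnI ac; split=> //; lia.
Qed.

Definition emptyr : real := fun=> false.

(** Membership under a name of its own, which makes atomic formulas recognizable
    to the tactic [definable]. *)
Definition holds (X : real) (k : nat) : Prop := X k.

(** Definability is stated for functions and predicates of the two environments,
    rather than for formulas.  This gives a shallow embedding: formulas are
    written as propositions, and the closure lemmas below translate them. *)
Definition term_def (t : seq nat -> nat) :=
  exists u, forall e, term_val e u = t e.
Definition set_def (S : seq real -> real) :=
  exists i, forall E, nth emptyr E i = S E.
Definition pred_def (P : seq nat -> seq real -> Prop) :=
  exists phi, forall e E, sat e E phi <-> P e E.

(** Under a quantifier, the outer variables live in a tail of the environment. *)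
Definition shift (T : Type) (r : seq T -> seq T) :=
  exists j, forall e, r e = drop j e.

Lemma shift_id T : shift (fun e : seq T => e).
Proof. by exists 0 => e; rewrite drop0. Qed.

Lemma shift_behead T (r : seq T -> seq T) :
  shift r -> shift (fun e => behead (r e)).
Proof. by move=> [j hj]; exists j.+1 => e; rewrite hj -drop1 drop_drop. Qed.

Section terms.
Implicit Types t u : seq nat -> nat.

Lemma term_def_head : term_def (fun e => head 0 e).
Proof. by exists (t_var 0) => -[]. Qed.

Lemma term_def_shift t r : term_def t -> shift r -> term_def (fun e => t (r e)).
Proof.
move=> [u ut] [j rj].
exists ((fix lift (u : term) : term := match u with
  | t_var i => t_var (j + i)
  | t_add u v => t_add (lift u) (lift v)
  | t_mul u v => t_mul (lift u) (lift v)
  | _ => u end) u) => e.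
rewrite -ut rj; elim: u {ut} => //= [i|u -> v ->//|u -> v ->//].
by rewrite nth_drop.
Qed.

Lemma term_def_cst n : term_def (fun=> n).
Proof.
elim: n => [|n [u ut]]; first by exists t_zero.
by exists (t_add u t_one) => e /=; rewrite ut addn1.
Qed.

Lemma term_def_add t u : term_def t -> term_def u ->
  term_def (fun e => t e + u e).
Proof. by move=> [t' ht] [u' hu]; exists (t_add t' u') => e /=; rewrite ht hu. Qed.

Lemma term_def_mul t u : term_def t -> term_def u ->
  term_def (fun e => t e * u e).
Proof. by move=> [t' ht] [u' hu]; exists (t_mul t' u') => e /=; rewrite ht hu. Qed.

Lemma term_def_succ t : term_def t -> term_def (fun e => (t e).+1).
Proof. by move=> [t' ht]; exists (t_add t' t_one) => e /=; rewrite ht addn1. Qed.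

Lemma term_def_pair t u : term_def t -> term_def u ->
  term_def (fun e => npair (t e) (u e)).
Proof.
by move=> ht hu; apply: term_def_add => //; apply: term_def_mul;
  apply: term_def_add.
Qed.

End terms.

Lemma set_def_head : set_def (fun E => head emptyr E).
Proof. by exists 0 => -[]. Qed.

Lemma set_def_shift S r : set_def S -> shift r -> set_def (fun E => S (r E)).
Proof.
by move=> [i hi] [j rj]; exists (j + i) => E; rewrite -hi rj nth_drop.
Qed.

Section predicates.
Implicit Types P Q : seq nat -> seq real -> Prop.

Lemma pred_def_eq t u : term_def t -> term_def u ->
  pred_def (fun e _ => t e = u e).
Proof. by move=> [t' ht] [u' hu]; exists (f_eq t' u') => e E /=; rewrite ht hu. Qed.

Lemma pred_def_lt t u : term_def t -> term_def u ->
  pred_def (fun e _ => t e < u e).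
Proof. by move=> [t' ht] [u' hu]; exists (f_lt t' u') => e E /=; rewrite ht hu. Qed.

Lemma pred_def_le t u : term_def t -> term_def u ->
  pred_def (fun e _ => t e <= u e).
Proof. by move=> ht hu; apply: pred_def_lt ht (term_def_succ hu). Qed.

Lemma pred_def_in t S : term_def t -> set_def S ->
  pred_def (fun e E => holds (S E) (t e)).
Proof. by move=> [t' ht] [i hi]; exists (f_in t' i) => e E /=; rewrite ht -hi. Qed.

Lemma pred_def_not P : pred_def P -> pred_def (fun e E => ~ P e E).
Proof. by move=> [p hp]; exists (f_not p) => e E /=; rewrite hp. Qed.

Lemma pred_def_and P Q : pred_def P -> pred_def Q ->
  pred_def (fun e E => P e E /\ Q e E).
Proof. by move=> [p hp] [q hq]; exists (f_and p q) => e E /=; rewrite hp hq. Qed.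

Lemma pred_def_ext P Q : (forall e E, P e E <-> Q e E) ->
  pred_def P -> pred_def Q.
Proof. by move=> PQ [p hp]; exists p => e E; rewrite hp PQ. Qed.

Lemma pred_def_or P Q : pred_def P -> pred_def Q ->
  pred_def (fun e E => P e E \/ Q e E).
Proof.
move=> hp hq; apply: pred_def_ext (pred_def_not
  (pred_def_and (pred_def_not hp) (pred_def_not hq))) => e E.
by rewrite not_andE !notE.
Qed.

Lemma pred_def_imp P Q : pred_def P -> pred_def Q ->
  pred_def (fun e E => P e E -> Q e E).
Proof.
move=> hp hq; apply: pred_def_ext (pred_def_or (pred_def_not hp) hq) => e E.
by rewrite implyE.
Qed.

Lemma pred_def_iff P Q : pred_def P -> pred_def Q ->
  pred_def (fun e E => P e E <-> Q e E).
Proof. by move=> hp hq; apply: pred_def_and; exact: pred_def_imp. Qed.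

(** The bound variable is the head of the extended environment, and the other
    variables are read in its tail. *)
Lemma pred_def_exN (Q : nat -> seq nat -> seq real -> Prop) :
  pred_def (fun e E => Q (head 0 e) (behead e) E) ->
  pred_def (fun e E => exists k, Q k e E).
Proof.
move=> [p hp]; exists (f_exN p) => e E /=.
by split=> -[k hk]; exists k; apply/(hp (k :: e) E).
Qed.

Lemma pred_def_allN (Q : nat -> seq nat -> seq real -> Prop) :
  pred_def (fun e E => Q (head 0 e) (behead e) E) ->
  pred_def (fun e E => forall k, Q k e E).
Proof.
move=> hp; have := pred_def_not (@pred_def_exN (fun k e E => ~ Q k e E)
  (pred_def_not hp)).
apply: pred_def_ext => e E; split=> [h k|h [k]//].
by apply: contrapT => hk; apply: h; exists k.
Qed.

Lemma pred_def_exS (Q : real -> seq nat -> seq real -> Prop) :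
  pred_def (fun e E => Q (head emptyr E) e (behead E)) ->
  pred_def (fun e E => exists X, Q X e E).
Proof.
move=> [p hp]; exists (f_exS p) => e E /=.
by split=> -[X hX]; exists X; apply/(hp e (X :: E)).
Qed.

Lemma pred_def_allS (Q : real -> seq nat -> seq real -> Prop) :
  pred_def (fun e E => Q (head emptyr E) e (behead E)) ->
  pred_def (fun e E => forall X, Q X e E).
Proof.
move=> hp; have := pred_def_not (@pred_def_exS (fun k e E => ~ Q k e E)
  (pred_def_not hp)).
apply: pred_def_ext => e E; split=> [h k|h [k]//].
by apply: contrapT => hk; apply: h; exists k.
Qed.

End predicates.

Ltac shift_tac := lazymatch goal with
  | |- shift (fun e => behead (@?r e)) =>
      apply (@shift_behead _ r); cbv beta; shift_tac
  | |- shift (fun e => e) => exact (@shift_id _)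
  end.

Ltac term_tac := lazymatch goal with
  | |- term_def (fun e => npair (@?a e) (@?b e)) =>
      apply (@term_def_pair a b); cbv beta; term_tac
  | |- term_def (fun e => @?a e + @?b e) =>
      apply (@term_def_add a b); cbv beta; term_tac
  | |- term_def (fun e => @?a e * @?b e) =>
      apply (@term_def_mul a b); cbv beta; term_tac
  | |- term_def (fun e => (@?a e).+1) =>
      apply (@term_def_succ a); cbv beta; term_tac
  | |- term_def (fun e => head 0 e) => exact term_def_head
  | |- term_def (fun _ => ?n) => exact (term_def_cst n)
  | H : term_def ?t |- term_def (fun e => ?t e) => exact H
  | H : term_def ?t |- term_def ?t => exact H
  | |- term_def (fun e => ?t (@?r e)) =>
      apply (@term_def_shift t r);
      [first [assumption | exact term_def_head] | shift_tac]
  end.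

Ltac set_tac := lazymatch goal with
  | |- set_def (fun E => head emptyr E) => exact set_def_head
  | H : set_def ?t |- set_def (fun e => ?t e) => exact H
  | H : set_def ?t |- set_def ?t => exact H
  | |- set_def (fun e => ?t (@?r e)) =>
      apply (@set_def_shift t r);
      [first [assumption | exact set_def_head] | shift_tac]
  end.

Create HintDb definable.

(** Translation by recursion on the proposition; the hint database supplies the
    predicates that were already shown definable. *)
Ltac definable := cbv beta; lazymatch goal with
  | |- pred_def (fun e E => @?P e E /\ @?Q e E) =>
      apply (@pred_def_and P Q); definable
  | |- pred_def (fun e E => @?P e E <-> @?Q e E) =>
      apply (@pred_def_iff P Q); definable
  | |- pred_def (fun e E => ~ @?P e E) =>
      apply (@pred_def_not P); definable
  | |- pred_def (fun e E => forall k : nat, @?Q k e E) =>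
      apply (@pred_def_allN (fun k e E => Q k e E)); definable
  | |- pred_def (fun e E => exists k : nat, @?Q k e E) =>
      apply (@pred_def_exN (fun k e E => Q k e E)); definable
  | |- pred_def (fun e E => forall X : real, @?Q X e E) =>
      apply (@pred_def_allS (fun X e E => Q X e E)); definable
  | |- pred_def (fun e E => exists X : real, @?Q X e E) =>
      apply (@pred_def_exS (fun X e E => Q X e E)); definable
  | |- pred_def (fun e E => @?P e E -> @?Q e E) =>
      apply (@pred_def_imp P Q); definable
  | |- pred_def (fun e E => @?t e = @?u e) =>
      apply (@pred_def_eq t u); term_tac
  | |- pred_def (fun e E => is_true (@?t e < @?u e)) =>
      apply (@pred_def_lt t u); term_tac
  | |- pred_def (fun e E => is_true (@?t e <= @?u e)) =>
      apply (@pred_def_le t u); term_tac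
  | |- pred_def (fun e E => holds (@?S E) (@?t e)) =>
      apply (@pred_def_in t S); [term_tac | set_tac]
  | |- _ => (auto with definable nocore);
      first [term_tac | set_tac | idtac]
  end.

(** The environments have default values, so an out-of-range variable denotes 0 or
    the empty set and can be replaced by a closed expression.  Hence
    well-formedness need not be tracked through the closure lemmas. *)
Fixpoint term_close n (t : term) : term :=
  match t with
  | t_var i => if i < n then t_var i else t_zero
  | t_add t u => t_add (term_close n t) (term_close n u)
  | t_mul t u => t_mul (term_close n t) (term_close n u)
  | _ => t
  end.

Fixpoint formula_close n m (f : formula) : formula :=
  match f with
  | f_eq t u => f_eq (term_close n t) (term_close n u)
  | f_lt t u => f_lt (term_close n t) (term_close n u)
  | f_in t i => if i < m then f_in (term_close n t) i
                else f_not (f_eq t_zero t_zero)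
  | f_not f => f_not (formula_close n m f)
  | f_and f g => f_and (formula_close n m f) (formula_close n m g)
  | f_exN f => f_exN (formula_close n.+1 m f)
  | f_exS f => f_exS (formula_close n m.+1 f)
  end.

Lemma term_close_wf n t : term_wf n (term_close n t).
Proof. by elim: t => //= [i|t -> u ->//|t -> u ->//]; case: ifP. Qed.

Lemma formula_close_wf n m f : formula_wf n m (formula_close n m f).
Proof.
elim: f n m => //= [t u|t u|t i|f IHf g IHg] n m; rewrite ?term_close_wf//.
- by case: ifP => //= ->; rewrite term_close_wf.
- by rewrite IHf IHg.
Qed.

Lemma term_close_val e t : term_val e (term_close (size e) t) = term_val e t.
Proof.
elim: t => //= [i|t -> u ->//|t -> u ->//].
by case: ltnP => // h; rewrite nth_default.
Qed.

Lemma formula_close_sat e E f :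
  sat e E (formula_close (size e) (size E) f) <-> sat e E f.
Proof.
elim: f e E => /= [t u|t u|t i|f IH|f IHf g IHg|f IH|f IH] e E.
- by rewrite !term_close_val.
- by rewrite !term_close_val.
- case: ltnP => h /=; first by rewrite term_close_val.
  by rewrite nth_default//; split.
- by rewrite IH.
- by rewrite IHf IHg.
- by split=> -[k hk]; exists k; apply/(IH (k :: e)).
- by split=> -[X hX]; exists X; apply/(IH e (X :: E)).
Qed.

Lemma pred_def_class (P : real -> Prop) :
  pred_def (fun _ E => P (head emptyr E)) ->
  exists2 phi, formula_wf 0 1 phi & defined_class phi = [set x | P x].
Proof.
move=> [phi hphi]; exists (formula_close 0 1 phi).
  exact: formula_close_wf.
apply/seteqP; split=> x; rewrite /defined_class /=.
  by move=> /(formula_close_sat [::] [:: x])/hphi.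
by move=> Px; apply/(formula_close_sat [::] [:: x])/hphi.
Qed.

(** * Evaluation of programs is definable *)

(** Structural induction that reaches the programs inside the list argument of
    [r_comp]. *)
Lemma recfun_ind_nested (P : recfun -> Prop) :
  P r_zero -> P r_succ -> (forall i, P (r_proj i)) ->
  (forall f gs, P f -> foldr (fun g => and (P g)) True gs -> P (r_comp f gs)) ->
  (forall f g, P f -> P g -> P (r_prec f g)) -> (forall f, P f -> P (r_mu f)) ->
  forall c, P c.
Proof.
move=> P0 PS Pp Pc Pr Pm.
fix IH 1 => -[||i|f gs|f g|f].
- exact: P0.
- exact: PS.
- exact: Pp.
- apply: Pc; first exact: IH.
  by elim: gs => [|g gs IHgs] /=; [|split; [exact: IH|]].
- by apply: Pr; exact: IH.
- by apply: Pm; exact: IH.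
Qed.

Notation code_cons x l := (npair x l).+1.

Definition code_seq (xs : seq nat) : nat :=
  foldr (fun x l => code_cons x l) 0 xs.

Fixpoint code_recfun (c : recfun) : nat :=
  match c with
  | r_zero => npair 0 0
  | r_succ => npair 1 0
  | r_proj i => npair 2 i
  | r_comp f gs => npair 3 (npair (code_recfun f) (code_seq (map code_recfun gs)))
  | r_prec f g => npair 4 (npair (code_recfun f) (code_recfun g))
  | r_mu f => npair 5 (code_recfun f)
  end.

(** A set of numbers read as a set of triples of a program, a list of arguments
    and a value. *)
Notation evals X c l y := (holds X (npair c (npair l y))).

(** The clauses of the semantics of programs, one for each way to obtain a value.
    Lists of programs get the tag 6, and their value is the list of the values,
    which makes the clause of composition first-order.  An absent argument
    reads as 0, hence the separate clauses for the empty list, whose code is 0. *)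
Definition eval_closed (X : real) : Prop :=
  (forall l, evals X (npair 0 0) l 0) /\
  (evals X (npair 1 0) 0 1) /\
  (forall x l, evals X (npair 1 0) (code_cons x l) x.+1) /\
  (forall i, evals X (npair 2 i) 0 0) /\
  (forall x l, evals X (npair 2 0) (code_cons x l) x) /\
  (forall i x l y, evals X (npair 2 i) l y ->
     evals X (npair 2 i.+1) (code_cons x l) y) /\
  (forall l, evals X (npair 6 0) l 0) /\
  (forall g gs l z zs, evals X g l z -> evals X (npair 6 gs) l zs ->
     evals X (npair 6 (code_cons g gs)) l (code_cons z zs)) /\
  (forall f gs l ys y, evals X (npair 6 gs) l ys -> evals X f ys y ->
     evals X (npair 3 (npair f gs)) l y) /\
  (forall f g z, evals X f 0 z -> evals X (npair 4 (npair f g)) 0 z) /\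
  (forall f g l z, evals X f l z ->
     evals X (npair 4 (npair f g)) (code_cons 0 l) z) /\
  (forall f g n l u z, evals X (npair 4 (npair f g)) (code_cons n l) u ->
     evals X g (code_cons n (code_cons u l)) z ->
     evals X (npair 4 (npair f g)) (code_cons n.+1 l) z) /\
  (forall f l y, evals X f (code_cons y l) 0 ->
     (forall n, n < y -> exists z, evals X f (code_cons n l) z.+1) ->
     evals X (npair 5 f) l y).

(** Evaluation as the least set closed under the clauses. *)
Definition eval (c l y : nat) := forall X, eval_closed X -> evals X c l y.

Lemma pred_def_eval t u v : term_def t -> term_def u -> term_def v ->
  pred_def (fun e _ => eval (t e) (u e) (v e)).
Proof. by move=> ht hu hv; rewrite /eval /eval_closed; definable. Qed.

#[local] Hint Extern 1 (pred_def (fun e E => eval (@?t e) (@?u e) (@?v e))) =>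
  apply (@pred_def_eval t u v); term_tac : definable.

Lemma eval_complete c xs y :
  rec_eval c xs y -> eval (code_recfun c) (code_seq xs) y.
Proof.
move=> h X HX; move: c xs y h.
case: HX => Z [S0 [S [P0 [Pc [PS [L0 [LS [C [R00 [R0 [RS M]]]]]]]]]]].
elim/recfun_ind_nested => [||i|f gs IHf IHgs|f g IHf IHg|f IHf] xs y /=.
- by move->.
- by move->; case: xs => [|x xs] /=.
- move->; elim: i xs => [|i IH] [|x xs] //=; exact: PS.
- move=> [ys [hgs /IHf hf]]; apply: C hf.
  elim: gs ys IHgs hgs => [|g gs IH] [|z zs] //= [IHg IHgs] [/IHg hz hzs].
  by apply: LS => //; exact: IH.
- case: xs => [|n xs] /=; first by move=> /IHf; exact: R00.
  elim: n y => [|n IH] y; first by move=> /IHf; exact: R0.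
  by move=> [u [/IH hu /IHg hg]]; apply: RS hu hg.
- move=> [/IHf h0 hn]; apply: M => // n /hn [z /IHf hz]; by exists z.
Qed.

(** The correct triples form a closed set, which contains the least one.
    Correctness only speaks about numbers that are codes, so numbers that code
    nothing satisfy the clauses for free. *)
Lemma eval_sound c xs y :
  eval (code_recfun c) (code_seq xs) y -> rec_eval c xs y.
Proof.
pose sound k l z := (forall c xs, k = code_recfun c -> l = code_seq xs ->
     rec_eval c xs z) /\
  (forall gs xs, k = npair 6 (code_seq (map code_recfun gs)) ->
     l = code_seq xs -> exists2 ys, z = code_seq ys &
       all2P (fun g z => rec_eval g xs z) gs ys).
pose X : real := fun n => `[< exists k l y, n = npair k (npair l y) /\ sound k l y >].
have XP k l z : evals X k l z <-> sound k l z.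
  split=> [/asboolP[k' [l' [z' [/npair_inj[-> /npair_inj[-> ->]]]]]]//|h].
  by apply/asboolP; exists k, l, z.
move=> /(_ X) /= h; suff /h/XP[hc _] : eval_closed X by exact: hc.
have prog k l z : (forall t, k <> npair 6 t) ->
    (forall c xs, k = code_recfun c -> l = code_seq xs -> rec_eval c xs z) ->
    evals X k l z.
  by move=> k6 hc; apply/XP; split=> // gs ? /k6.
have progs k l z : (forall gs xs, k = code_seq (map code_recfun gs) ->
     l = code_seq xs -> exists2 ys, z = code_seq ys &
       all2P (fun g z => rec_eval g xs z) gs ys) -> evals X (npair 6 k) l z.
  move=> hgs; apply/XP; split=> [[||?|??|??|?] ? /npair_inj[]//|gs us].
  by move=> /npair_inj[_]; exact: hgs.
have nil us : 0 = code_seq us -> us = [::] by case: us.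
have cons x k us : code_cons x k = code_seq us ->
    exists2 vs, us = x :: vs & k = code_seq vs.
  by case: us => //= u us [] /npair_inj[-> ->]; exists us.
rewrite /eval_closed; do !(apply: conj).
- move=> l; apply: prog => [t /npair_inj[]//|].
  by move=> [||?|??|??|?] us /npair_inj[].
- apply: prog => [t /npair_inj[]//|].
  by move=> [||?|??|??|?] us /npair_inj[]// _ _ /nil ->.
- move=> x l; apply: prog => [t /npair_inj[]//|].
  by move=> [||?|??|??|?] us /npair_inj[]// _ _ /cons[vs ->].
- move=> i; apply: prog => [t /npair_inj[]//|].
  by move=> [||?|??|??|?] us /npair_inj[]// _ _ /nil -> /=; rewrite nth_nil.
- move=> x l; apply: prog => [t /npair_inj[]//|].
  by move=> [||?|??|??|?] us /npair_inj[]// _ <- /cons[vs ->].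
- move=> i x l z /XP[hz _]; apply: prog => [t /npair_inj[]//|].
  move=> [||?|??|??|?] us /npair_inj[]// _ <- /cons[vs -> /=].
  exact: (hz (r_proj i)).
- move=> l; apply: progs => -[|//] us _ _; by exists [::].
- move=> g gs l z zs /XP[hg _] /XP[_ hgs]; apply: progs => -[//|g' gs'] us /=.
  move=> [] /npair_inj[gE gsE] lE.
  have [ys -> hys] := hgs gs' us (congr1 (npair 6) gsE) lE.
  by exists (z :: ys) => //=; split => //; exact: hg gE lE.
- move=> f gs l ys z /XP[_ hgs] /XP[hf _]; apply: prog => [t /npair_inj[]//|].
  move=> [||?|f' gs'|??|?] us /npair_inj[]// _ /npair_inj[fE gsE] lE.
  have [ys' ysE hys] := hgs gs' us (congr1 (npair 6) gsE) lE.
  by exists ys'; split => //; exact: hf fE ysE.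
- move=> f g z /XP[hf _]; apply: prog => [t /npair_inj[]//|].
  move=> [||?|??|f' g'|?] us /npair_inj[]// _ /npair_inj[fE gE] /nil -> /=.
  exact: hf fE _.
- move=> f g l z /XP[hf _]; apply: prog => [t /npair_inj[]//|].
  move=> [||?|??|f' g'|?] us /npair_inj[]// _ /npair_inj[fE gE] /cons[vs -> lE] /=.
  exact: hf fE _.
- move=> f g n l u z /XP[hu _] /XP[hg _]; apply: prog => [t /npair_inj[]//|].
  move=> [||?|??|f' g'|?] us /npair_inj[]// _ /npair_inj[fE gE] /cons[vs -> lE].
  exists u; split.
    by apply: (hu (r_prec f' g') (n :: vs)); rewrite /= ?fE ?gE ?lE.
  by apply: hg => //=; rewrite lE.
- move=> f l z /XP[h0 _] hn; apply: prog => [t /npair_inj[]//|].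
  move=> [||?|??|??|f'] us /npair_inj[]// _ fE lE; split.
    by apply: h0 => //=; rewrite lE.
  move=> n /hn [u /XP[hu _]]; exists u; by apply: hu => //=; rewrite lE.
Qed.

(** * Strings and open sets *)

Lemma strcode_rcons s b : strcode (rcons s b) = (strcode s).*2 + b.+1.
Proof. by rewrite /strcode foldl_rcons. Qed.

Lemma strcode_inj : injective strcode.
Proof.
elim/last_ind=> [|s b IH] t; case/lastP: t => [|t c]; rewrite ?strcode_rcons //.
- by rewrite addnS.
- by rewrite addnS.
move=> h; have bc : b = c by move: h; case: b c => [] [] //; lia.
by move: h; rewrite bc => /addIn/double_inj/IH ->.
Qed.

Lemma restrictS x l : restrict x l.+1 = rcons (restrict x l) (x l).
Proof. exact: mkseqS. Qed.

Lemma size_restrict x l : size (restrict x l) = l.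
Proof. exact: size_mkseq. Qed.

Lemma nth_restrict x l i : i < l -> nth false (restrict x l) i = x i.
Proof. exact: nth_mkseq. Qed.

Lemma restrict_nth l (t : l.-tuple bool) : restrict (nth false t) l = t.
Proof.
apply: (@eq_from_nth _ false) => [|i]; rewrite size_restrict ?size_tuple//.
exact: nth_restrict.
Qed.

Lemma take_restrict x l m : l <= m -> take l (restrict x m) = restrict x l.
Proof. by move=> lm; rewrite /restrict /mkseq -map_take take_iota (minn_idPl lm). Qed.

(** The number [k] codes the initial segment of length [l] of [x]: the recursion
    that computes the codes of the segments, written as a least fixed point. *)
Definition string_path (x : real) (l k : nat) := forall X : real,
  holds X (npair 0 0) ->
  (forall i j, holds X (npair i j) ->
     (holds x i -> holds X (npair i.+1 (j + j).+2)) /\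
     (~ holds x i -> holds X (npair i.+1 (j + j).+1))) ->
  holds X (npair l k).

Lemma pred_def_string_path S t u : set_def S -> term_def t -> term_def u ->
  pred_def (fun e E => string_path (S E) (t e) (u e)).
Proof. by move=> hS ht hu; rewrite /string_path; definable. Qed.
#[local] Hint Extern 1 (pred_def (fun e E => string_path (@?S E) (@?t e) (@?u e))) =>
  apply (@pred_def_string_path S t u); [set_tac|term_tac|term_tac] : definable.

Lemma string_pathP x l k : string_path x l k <-> k = strcode (restrict x l).
Proof.
split=> [|-> X X0 XS].
  pose X : real := fun n => `[< exists l, n = npair l (strcode (restrict x l)) >].
  have XP i j : holds X (npair i j) <-> j = strcode (restrict x i).
    by split=> [/asboolP[i' /npair_inj[-> ->]]//|->]; apply/asboolP; exists i.
  move=> /(_ X) h; apply/XP/h => [|i j /XP ->]; first exact/XP.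
  by split=> [xi|/negP/negbTE xi]; apply/XP;
    rewrite restrictS strcode_rcons -addnn (xi : x i = _) ?addn2 ?addn1.
elim: l => [//|l IH]; have [h1 h0] := XS _ _ IH.
rewrite restrictS strcode_rcons -addnn.
by case: (boolP (x l)) => xl; rewrite ?addn2 ?addn1; [exact: h1 | exact/h0/negP].
Qed.

(** The open set given by a set of codes of strings. *)
Definition open_of (W : nat -> Prop) : set real :=
  \bigcup_(s in [set s | W (strcode s)]) cylinder s.

(** The part of [open_of W] that the strings of length at most [L] cover; it is a
    union of cylinders of length [L]. *)
Definition covered (W : nat -> Prop) (L : nat) : set real :=
  [set x | exists l k, l <= L /\ string_path x l k /\ W k].

Lemma coveredP W L x :
  covered W L x <-> exists2 l, l <= L & W (strcode (restrict x l)).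
Proof.
split=> [[l [k [lL [/string_pathP -> ?]]]]|[l lL ?]]; exists l => //.
by exists (strcode (restrict x l)); split=> //; split=> //; exact/string_pathP.
Qed.

Lemma open_of_path W :
  open_of W = [set x | exists l k, string_path x l k /\ W k].
Proof.
apply/seteqP; split=> x.
  move=> [s Ws xs]; exists (size s), (strcode s); split=> //.
  by apply/string_pathP; rewrite [restrict _ _]xs.
move=> [l [_ [/string_pathP -> Wl]]]; exists (restrict x l) => //.
by rewrite /cylinder /= size_restrict.
Qed.

Lemma open_ofE W : open_of W = \bigcup_L covered W L.
Proof.
apply/seteqP; split=> x.
  move=> [s Ws xs]; exists (size s) => //; apply/coveredP; exists (size s) => //.
  by rewrite [restrict _ _]xs.
move=> [L _ /coveredP[l _ Wl]]; exists (restrict x l) => //.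
by rewrite /cylinder /= size_restrict.
Qed.

(** * The coin measure of open sets *)

(** The second-order form of a measure at most [2 ^- n].  Through its codes, [F] is
    an injection of the covered strings of length [L] into those that begin with
    [n] zeros, of which there are [2 ^ (L - n)]. *)
Definition thin (W : nat -> Prop) (n : nat) := forall L, n <= L ->
  exists F : real,
    (forall x, covered W L x -> exists k z k', string_path x L k /\
       (forall i, i < n -> ~ holds z i) /\ string_path z L k' /\
       holds F (npair k k')) /\
    (forall k1 k2 k', holds F (npair k1 k') -> holds F (npair k2 k') -> k1 = k2).

Definition covering_string (W : nat -> Prop) (L : nat) : pred (seq bool) :=
  fun t => `[< exists2 l, l <= L & W (strcode (take l t)) >].

Definition zeros_prefix (n : nat) : pred (seq bool) :=
  fun t => take n t == nseq n false.

Section coin.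
Context {R : realType}.
Local Open Scope ereal_scope.

Lemma measurable_cylinder s : measurable (cylinder s : set cantor).
Proof. by apply: sub_sigma_algebra; exists s. Qed.

Lemma restrict_bigcup (Q : pred (seq bool)) L :
  [set x | Q (restrict x L)] =
  \bigcup_(t in [set t : L.-tuple bool | Q t]) cylinder t.
Proof.
apply/seteqP; split=> x /=.
  move=> Qx; exists (Tuple (introT eqP (size_restrict x L))) => //=.
  by rewrite /cylinder /= size_restrict.
move=> [t /= Qt]; rewrite /cylinder /= size_tuple => xt.
by rewrite xt.
Qed.

Lemma measurable_restrict (Q : pred (seq bool)) L :
  measurable ([set x | Q (restrict x L)] : set cantor).
Proof.
rewrite restrict_bigcup; apply: fin_bigcup_measurable => // t _.
exact: measurable_cylinder.
Qed.

Lemma coin_restrict (Q : pred (seq bool)) L :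
  coin R [set x | Q (restrict x L)] =
  ((#|finset (fun t : L.-tuple bool => Q t)|)%:R / 2 ^+ L)%:E.
Proof.
rewrite restrict_bigcup measure_fin_bigcup //; last 2 first.
- apply/trivIsetP => /= s t _ _ st; rewrite -subset0 => x [].
  rewrite /cylinder /= !size_tuple => xs xt.
  by move: st; rewrite -val_eqE /= -xs -xt eqxx.
- by move=> t _; exact: measurable_cylinder.
rewrite -(@bigfs _ _ _ _ (index_enum _) (fun t : L.-tuple bool => Q t)).
- rewrite (eq_bigr (fun=> (2 ^- L)%:E)) => [|t _]; last first.
    by rewrite -{2}(size_tuple t); exact: coin_cylinder.
  by rewrite sumEFin sumr_const [in RHS]cardsE [in RHS]mulr_natl.
- exact: index_enum_uniq.
- by move=> t _; rewrite mem_index_enum.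
- exact: finite_finset.
Qed.

(** At a fixed level, comparing measures is comparing cardinalities. *)
Lemma coin_restrict_le (Q P : pred (seq bool)) L :
  (coin R [set x | Q (restrict x L)] <= coin R [set x | P (restrict x L)]) =
  (#|finset (fun t : L.-tuple bool => Q t)| <=
   #|finset (fun t : L.-tuple bool => P t)|)%N.
Proof.
by rewrite !coin_restrict lee_fin ler_pM2r ?invr_gt0 ?exprn_gt0// ler_nat.
Qed.

Lemma covered_restrict W L :
  covered W L = [set x | covering_string W L (restrict x L)].
Proof.
apply/seteqP; split=> x.
  move=> /coveredP[l lL Wl]; apply/asboolP; exists l => //.
  by rewrite take_restrict.
move=> /asboolP[l lL]; rewrite take_restrict// => Wl.
by apply/coveredP; exists l.
Qed.

Lemma measurable_covered W L : measurable (covered W L : set cantor).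
Proof. rewrite covered_restrict; exact: measurable_restrict. Qed.

Lemma measurable_open_of W : measurable (open_of W : set cantor).
Proof.
rewrite open_ofE; apply: bigcupT_measurable => L; exact: measurable_covered.
Qed.

(** Continuity from below along the levels, of which any final segment is enough. *)
Lemma coin_open_of_le W n (r : \bar R) : (coin R (open_of W) <= r) <->
  forall L, (n <= L)%N -> coin R (covered W L) <= r.
Proof.
split=> [h L _|h].
  apply: le_trans h; rewrite open_ofE; apply: le_measure; rewrite ?inE.
  - exact: measurable_covered.
  - by rewrite -open_ofE; exact: measurable_open_of.
  - by move=> x xL; exists L.
have cv : (coin R \o covered W) x @[x --> \oo] --> coin R (open_of W).
  rewrite open_ofE; apply: nondecreasing_cvg_mu.
  - by move=> L; exact: measurable_covered.
  - by rewrite -open_ofE; exact: measurable_open_of.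
  - move=> l m lm; apply/subsetPset => x /coveredP[k kl Wk]; apply/coveredP.
    by exists k => //; exact: leq_trans lm.
rewrite -(cvg_lim _ cv)//; apply: lime_le; first by apply/cvg_ex; eexists; exact: cv.
by exists n => // L /= nL; exact: h.
Qed.

Lemma coin_zeros n L : (n <= L)%N ->
  coin R [set x | zeros_prefix n (restrict x L)] = (2 ^- n)%:E.
Proof.
move=> nL; rewrite -[in RHS](size_nseq n false) -coin_cylinder; congr (coin R _).
apply/seteqP; split=> x; rewrite /cylinder /zeros_prefix /= size_nseq take_restrict//.
  by move=> /eqP.
by move=> ->.
Qed.

(** A finite set injects into another iff it has at most as many elements; in the
    converse direction the enumerations of the two sets are matched. *)
Lemma thin_card W n : thin W n <-> forall L, (n <= L)%N ->
  (#|finset (fun t : L.-tuple bool => covering_string W L t)| <=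
   #|finset (fun t : L.-tuple bool => zeros_prefix n t)|)%N.
Proof.
split=> h L nL.
  have [F [Fcov Finj]] := h _ nL.
  have : forall t : L.-tuple bool, exists t' : L.-tuple bool, covering_string W L t ->
      zeros_prefix n t' /\ holds F (npair (strcode t) (strcode t')).
    move=> t; have [ct|/negP nt] := boolP (covering_string W L t); last by exists t.
    pose x : real := nth false t.
    have xt : restrict x L = t := restrict_nth t.
    have /Fcov[k [z [k' [/string_pathP -> [z0 [/string_pathP -> Fz]]]]]] :
        covered W L x by rewrite covered_restrict /= xt.
    exists (Tuple (introT eqP (size_restrict z L))) => _; split.
      rewrite /zeros_prefix /= take_restrict//; apply/eqP/(@eq_from_nth _ false).
        by rewrite size_restrict size_nseq.
      move=> i; rewrite size_restrict => ilt; rewrite nth_restrict// nth_nseq ilt.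
      exact/negbTE/negP/z0.
    by rewrite -xt.
  move=> /choice[f hf]; rewrite -(@card_in_imset _ _ f); last first.
    move=> s t; rewrite !finset.in_set => cs ct st.
    have [[_ Fs] [_ Ft]] := (hf s cs, hf t ct).
    by apply/val_inj/strcode_inj/(Finj _ _ (strcode (f s))) => //; rewrite st.
  apply/subset_leq_card/fintype.subsetP => _ /imsetP[t + ->]; rewrite !finset.in_set.
  by move=> /(hf t)[].
have := h _ nL; set A := finset _; set B := finset _ => AB.
pose f (t : L.-tuple bool) := nth t (enum B) (index t (enum A)).
have lt t : t \in A -> (index t (enum A) < size (enum B))%N.
  by move=> tA; rewrite -cardE (leq_trans _ AB)// [ltnRHS]cardE index_mem mem_enum.
have fB t : t \in A -> f t \in B.
  by move=> tA; rewrite -mem_enum mem_nth// lt.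
exists (fun m => `[< exists2 t, t \in A & m = npair (strcode t) (strcode (f t)) >]).
split=> [x|k1 k2 k' /asboolP[t1 A1 /npair_inj[-> ->]] /asboolP[t2 A2 /npair_inj[->]]].
  rewrite covered_restrict => cx.
  pose t : L.-tuple bool := Tuple (introT eqP (size_restrict x L)).
  have tA : t \in A by rewrite finset.in_set.
  exists (strcode t), (nth false (f t)), (strcode (f t)); split.
    exact/string_pathP.
  split=> [i ilt|].
    move: (fB _ tA); rewrite finset.in_set => /eqP /(congr1 (fun s => nth false s i)).
    by rewrite nth_take// nth_nseq ilt /holds => ->.
  split; last by apply/asboolP; exists t.
  by apply/string_pathP; rewrite restrict_nth.
move=> /strcode_inj/val_inj; rewrite /f.
rewrite (set_nth_default t2 t1) ?lt// => /eqP; rewrite nth_uniq ?lt ?enum_uniq//.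
move=> /eqP ii; rewrite -(nth_index t2 (s := enum A) (x := t1)) ?mem_enum//.
by rewrite ii nth_index ?mem_enum.
Qed.

Lemma thinP W n : thin W n <-> coin R (open_of W) <= (2 ^- n)%:E.
Proof.
rewrite thin_card (coin_open_of_le _ n); split=> h L nL; have := h L nL;
  by rewrite -coin_restrict_le coin_zeros// -covered_restrict.
Qed.

End coin.

(** * A definable Martin-Loef random real *)

(** With 0 before 1: at the first difference, [x] cannot be the one holding 1. *)
Definition lex_le (x y : real) := forall n,
  (forall i, i < n -> (holds x i <-> holds y i)) -> holds x n -> holds y n.

Definition lex_least (K : real -> Prop) (x : real) :=
  K x /\ forall y, K y -> lex_le x y.

Lemma lex_le_anti x y : lex_le x y -> lex_le y x -> x = y.
Proof.
move=> xy yx; suff h n : holds x n <-> holds y n.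
  by apply/funext => n; apply/idP/idP => /h.
elim/ltn_ind: n => n IH; split; first exact: xy.
by apply: yx => i /IH [h1 h2]; split.
Qed.

(** The least element is found bit by bit, taking 0 whenever the string so far
    followed by 0 still has an extension in the set.  It belongs to the set
    because each of its initial segments has an extension there and the
    complement is open. *)
Lemma lex_least_exists W : ~` open_of W !=set0 ->
  exists x, lex_least (~` open_of W) x.
Proof.
set K := ~` open_of W => -[z Kz].
pose ext s := exists2 x, K x & restrict x (size s) = s.
pose step s := rcons s (~~ `[< ext (rcons s false) >]).
pose pre n := iter n step [::].
have spre n : size (pre n) = n.
  by elim: n => //= n IH; rewrite size_rcons IH.
have extpre n : ext (pre n).
  elim: n => [|n [x Kx xn]] /=; first by exists z.
  rewrite /step; case: asboolP => //= nf; exists x => //.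
  rewrite size_rcons restrictS xn; case xs: (x _) => //.
  by case: nf; exists x => //; rewrite size_rcons restrictS xn xs.
pose a n := ~~ `[< ext (rcons (pre n) false) >].
have apre n : restrict a n = pre n.
  by elim: n => // n IH; rewrite restrictS IH.
exists a; split=> [|y Ky n agree an].
  move=> [s Ws]; rewrite /cylinder /= apre => sE.
  have [x Kx] := extpre (size s); rewrite spre sE => xs.
  by apply: Kx; exists s.
apply: contraT => /negbTE yn; move: an => /asboolPn[].
exists y => //; rewrite size_rcons spre restrictS yn -apre; congr rcons.
rewrite /restrict; apply/eq_in_map => i; rewrite mem_iota /= add0n => /agree[h1 h2].
by apply/idP/idP.
Qed.

(** The component of index [e + 2] of the sequence of open sets enumerated by the
    program [e]; the shift keeps the sum of all the bounds below 1. *)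
Definition prog_codes (e k : nat) : Prop :=
  exists y, eval e (code_cons e.+2 (code_cons k 0)) y.

(** Codes for a universal open set: the components that do respect their bound. *)
Definition unsafe_codes (k : nat) : Prop :=
  exists e, thin (prog_codes e) e.+2 /\ prog_codes e k.

Definition leftmost_safe : real -> Prop := lex_least
  (fun x => ~ exists l k, string_path x l k /\ unsafe_codes k).

Lemma pred_def_leftmost_safe : pred_def (fun _ E => leftmost_safe (head emptyr E)).
Proof.
have hp e k : term_def e -> term_def k ->
    pred_def (fun v _ => prog_codes (e v) (k v)).
  by move=> he hk; rewrite /prog_codes; definable.
have hu k : term_def k -> pred_def (fun v _ => unsafe_codes (k v)).
  move=> hk; rewrite /unsafe_codes /thin /covered /=; definable.
  1-2: match goal with |- pred_def (fun e E => prog_codes (@?t e) (@?u e)) =>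
    apply (hp t u); term_tac end.
rewrite /leftmost_safe /lex_least /lex_le; definable.
all: match goal with |- pred_def (fun e E => unsafe_codes (@?t e)) =>
    apply (hu t); term_tac end.
Qed.

(** A class with at most one element is smaller than the set of all reals. *)
Lemma not_typical_singleton P (a : real) : P a ->
  (forall x y, P x -> P y -> x = y) ->
  pred_def (fun _ E => P (head emptyr E)) -> ~ typical a.
Proof.
move=> Pa uniq /pred_def_class[phi wf E] /(_ phi wf); rewrite E => /(_ Pa).
rewrite card_eq_le => /andP[_ /pcard_leP[f]].
have fP x : P (f x) by exact: ('funS_f I).
have /(congr1 (fun x : real => x 0)) // : (fun=> true) = (fun=> false) :> real.
by apply: ('inj_f) (uniq _ _ (fP _) (fP _)); exact: mem_set.
Qed.

Section random.
Context {R : realType}.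

(** The bounds [2 ^- (e + 2)] sum to 1/2. *)
Lemma coin_unsafe_lt1 : (coin R (open_of unsafe_codes) < 1)%E.
Proof.
pose A e := if `[< thin (prog_codes e) e.+2 >] then open_of (prog_codes e) else set0.
have mA e : measurable (A e : set cantor).
  by rewrite /A; case: ifP => // _; exact: measurable_open_of.
have -> : open_of unsafe_codes = \bigcup_e A e.
  apply/seteqP; split=> x.
    move=> [s [e [he hs]] xs]; exists e => //; rewrite /A asboolT//.
    by exists s.
  move=> [e _]; rewrite /A; case: asboolP => // he [s hs xs].
  by exists s => //; exists e.
apply: (@le_lt_trans _ _ (2^-1 : R)%:E); last by rewrite lte_fin; lra.
apply: (@le_trans _ _ (\sum_(0 <= i <oo) (2^-1 / (2 ^ i.+1)%:R : R)%:E)%E); last first.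
  by apply: epsilon_trick0; rewrite invr_ge0.
apply: (@le_trans _ _ (\sum_(0 <= i <oo) coin R (A i))%E).
  by apply: generalized_Boole_inequality => //; exact: bigcupT_measurable.
apply: lee_nneseries => // e _; rewrite /A; case: asboolP => [/thinP|] h.
  apply: le_trans (h R) _; by rewrite lee_fin natrX -invfM -exprS.
by rewrite measure0 lee_fin divr_ge0.
Qed.

End random.

(** * Computable functions *)

Lemma rec_eval_inj c xs y z : rec_eval c xs y -> rec_eval c xs z -> y = z.
Proof.
elim/recfun_ind_nested: c xs y z => [||i|f gs IHf IHgs|f g IHf IHg|f IHf] xs y z /=.
- by move=> -> ->.
- by move=> -> ->.
- by move=> -> ->.
- move=> [us [gu fu]] [vs [gv fv]]; suff uv : us = vs by apply: IHf fu _; rewrite uv.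
  elim: gs us vs IHgs gu gv {fu fv} => [|g gs IH] [|u us] [|v vs] //= [IHg IHgs].
  by move=> [/IHg gu gus] [/gu -> gvs]; congr cons; exact: IH.
- elim: (head 0 xs) y z => [|n IH] y z; first exact: IHf.
  by move=> [u [pu gu]] [v [/(IH _ _ pu) <- gv]]; exact: IHg gu gv.
- move=> [y0 yn] [z0 zn]; have [yz|zy|//] := ltngtP y z.
    by have [u /(IHf _ _ _ y0)] := zn _ yz.
  by have [u /(IHf _ _ _ z0)] := yn _ zy.
Qed.

(** Totality on lists of every length lets functions be composed without counting
    arguments. *)
Definition computable (f : seq nat -> nat) :=
  exists c, forall xs, rec_eval c xs (f xs).

Section computable.
Implicit Types f g t u v : seq nat -> nat.

Lemma computable_ext f g : f =1 g -> computable f -> computable g.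
Proof. by move=> fg [c hc]; exists c => xs; rewrite -fg. Qed.

Lemma computable_nth i : computable (fun xs => nth 0 xs i).
Proof. by exists (r_proj i). Qed.

Lemma computable_succ t : computable t -> computable (fun xs => (t xs).+1).
Proof.
by move=> [c hc]; exists (r_comp r_succ [:: c]) => xs; exists [:: t xs].
Qed.

Lemma computable_cst n : computable (fun=> n).
Proof.
elim: n => [|n]; [by exists r_zero | exact: computable_succ].
Qed.

Lemma computable_app2 (f : nat -> nat -> nat) t u : computable2 f ->
  computable t -> computable u -> computable (fun xs => f (t xs) (u xs)).
Proof.
move=> [c hc] [ct ht] [cu hu]; exists (r_comp c [:: ct; cu]) => xs /=.
by exists [:: t xs; u xs].
Qed.

Lemma computable_rec (F : nat -> nat -> nat) (a : nat -> nat)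
    (b : nat -> nat -> nat -> nat) :
  (forall p, F 0 p = a p) -> (forall n p, F n.+1 p = b n (F n p) p) ->
  computable (fun xs => a (nth 0 xs 0)) ->
  computable (fun xs => b (nth 0 xs 0) (nth 0 xs 1) (nth 0 xs 2)) ->
  forall t u, computable t -> computable u ->
  computable (fun xs => F (t xs) (u xs)).
Proof.
move=> F0 FS [ca ha] [cb hb] t u ht hu.
suff hF : computable2 F by exact: computable_app2.
exists (r_prec ca cb) => m n /=; elim: m => [|m IH].
  by rewrite F0; exact: ha.
by exists (F m n); split=> //; rewrite FS; exact: hb.
Qed.

Lemma computable_rec0 (F : nat -> nat) (b : nat -> nat -> nat) :
  (forall n, F n.+1 = b n (F n)) ->
  computable (fun xs => b (nth 0 xs 0) (nth 0 xs 1)) ->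
  forall t, computable t -> computable (fun xs => F (t xs)).
Proof.
move=> FS hb t ht.
apply: (@computable_rec (fun n _ => F n) (fun=> F 0) (fun n r _ => b n r)
  _ _ _ _ t (fun=> 0)) => //; exact: computable_cst.
Qed.

Lemma computable_add t u : computable t -> computable u ->
  computable (fun xs => t xs + u xs).
Proof.
apply: (@computable_rec _ id (fun _ r _ => r.+1)) => //.
  exact: computable_nth.
by apply: computable_succ; exact: computable_nth.
Qed.

Lemma computable_mul t u : computable t -> computable u ->
  computable (fun xs => t xs * u xs).
Proof.
apply: (@computable_rec _ (fun=> 0) (fun _ r p => p + r)) => //.
  exact: computable_cst.
by apply: computable_add; exact: computable_nth.
Qed.

Lemma computable_pred t : computable t -> computable (fun xs => (t xs).-1).
Proof.
apply: (@computable_rec0 _ (fun n _ => n)) => //; exact: computable_nth.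
Qed.

Lemma computable_sub t u : computable t -> computable u ->
  computable (fun xs => t xs - u xs).
Proof.
move=> ht hu; apply: (@computable_rec (fun n p => p - n) id (fun _ r _ => r.-1)
  _ _ _ _ u t hu ht).
- by move=> p; rewrite subn0.
- by move=> n p; rewrite subnS.
- exact: computable_nth.
- by apply: computable_pred; exact: computable_nth.
Qed.

Lemma computable_odd t : computable t -> computable (fun xs => nat_of_bool (odd (t xs))).
Proof.
apply: (@computable_rec0 (fun n => nat_of_bool (odd n)) (fun _ r => 1 - r)) => [n|] /=.
  by case: odd.
by apply: computable_sub; [exact: computable_cst | exact: computable_nth].
Qed.

Lemma computable_half t : computable t -> computable (fun xs => (t xs)./2).
Proof.
apply: (@computable_rec0 half (fun n r => odd n + r)) => [n|] /=.
  by rewrite uphalf_half.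
by apply: computable_add; [apply: computable_odd|]; exact: computable_nth.
Qed.

Lemma computable_exp2 t : computable t -> computable (fun xs => 2 ^ t xs).
Proof.
apply: (@computable_rec0 (expn 2) (fun _ r => r + r)) => [n|] /=.
  by rewrite addnn -mul2n expnS.
by apply: computable_add; exact: computable_nth.
Qed.

Lemma computable_if0 t u v : computable t -> computable u -> computable v ->
  computable (fun xs => if t xs == 0 then u xs else v xs).
Proof.
move=> ht hu hv; apply: (@computable_ext
  (fun xs => (1 - t xs) * u xs + (1 - (1 - t xs)) * v xs)).
  by move=> xs; case: (t xs) => [|n] /=; rewrite ?subn0 ?subSS ?sub0n; lia.
by do ?[apply: computable_add|apply: computable_mul|apply: computable_sub
  |exact: computable_cst].
Qed.

(** On codes of strings, removing the last bit is [fun k => k.-1./2]. *)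
Definition ancestor (j k : nat) : nat := iter j (fun m => m.-1./2) k.

Lemma ancestor_rcons s b : (strcode (rcons s b)).-1./2 = strcode s.
Proof.
by rewrite strcode_rcons addnS /= addnC; case: b; rewrite /= ?uphalf_double ?doubleK.
Qed.

Lemma ancestor_le j k : ancestor j k <= k - j.
Proof.
elim: j => [|j IH]; first by rewrite subn0.
by rewrite /ancestor iterS -/(ancestor j k); lia.
Qed.

Lemma computable_ancestor t u : computable t -> computable u ->
  computable (fun xs => ancestor (t xs) (u xs)).
Proof.
apply: (@computable_rec _ id (fun _ r _ => r.-1./2)) => //.
  exact: computable_nth.
by apply/computable_half/computable_pred; exact: computable_nth.
Qed.

(** Recursion on strings is course-of-values recursion on their codes.  It is
    reduced to primitive recursion by climbing from the root to the string
    [s] in [strcode s] steps: step [i] visits the ancestor obtained by removing the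
    last [strcode s - i] bits, so the first steps stay at the root. *)
Lemma computable_string_rec (h : seq bool -> nat) (G : nat -> nat -> nat) :
  (forall s b, h (rcons s b) = G (strcode (rcons s b)) (h s)) ->
  (forall t u, computable t -> computable u ->
    computable (fun xs => G (t xs) (u xs))) ->
  exists2 f, forall s, f (strcode s) = h s &
    forall t, computable t -> computable (fun xs => f (t xs)).
Proof.
move=> hS cG.
pose F := fix F n k := match n with
  | 0 => h [::]
  | n.+1 => if ancestor (k - n.+1) k == 0 then F n k
            else G (ancestor (k - n.+1) k) (F n k) end.
exists (fun k => F k k) => [s|t ht]; last first.
  apply: (@computable_rec F (fun=> h [::]) (fun n r k =>
    if ancestor (k - n.+1) k == 0 then r else G (ancestor (k - n.+1) k) r)
    _ _ _ _ t t ht ht) => //; first exact: computable_cst.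
  have ca : computable (fun xs => ancestor (nth 0 xs 2 - (nth 0 xs 0).+1) (nth 0 xs 2)).
    apply: computable_ancestor; last exact: computable_nth.
    by apply: computable_sub; [|apply: computable_succ]; exact: computable_nth.
  by apply: computable_if0 => //; [|apply: cG => //]; exact: computable_nth.
set k := strcode s.
suff H n : n <= k -> forall s', ancestor (k - n) k = strcode s' -> F n k = h s'.
  by apply: (H k) => //; rewrite subnn.
elim: n => [_ s'|n IH nk s' sE].
  rewrite subn0; have := ancestor_le k k; rewrite subnn leqn0 => /eqP ->.
  by move=> /(@strcode_inj [::]) <-.
have step : ancestor (k - n) k = (ancestor (k - n.+1) k).-1./2.
  by rewrite -[in LHS](@subnSK n k)// /ancestor iterS.
rewrite /= -/F sE; case: eqVneq => [s0|].
  by apply: IH; [exact: ltnW | rewrite step sE s0].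
case/lastP: s' sE => // s' b sE _; rewrite hS; congr G.
by apply: IH; [exact: ltnW | rewrite step sE ancestor_rcons].
Qed.

(** The search ignores the searched number: it halts at once or never. *)
Lemma re2_eq0 (f : nat -> nat -> nat) :
  computable (fun xs => f (nth 0 xs 0) (nth 0 xs 1)) ->
  re2 (fun m n => f m n = 0).
Proof.
move=> [c hc]; pose c' := r_comp c [:: r_proj 1; r_proj 2].
have hc' y m n : rec_eval c' [:: y; m; n] (f m n) by exists [:: m; n].
exists (r_mu c') => m n; split=> [f0|[y [h _]]].
  by exists 0; split=> //; rewrite -f0; exact: hc'.
exact: rec_eval_inj (hc' _ _ _) h.
Qed.

End computable.

(** * A typical real with zeros at the even places *)

Fixpoint code_term (t : term) : nat :=
  match t with
  | t_var i => npair 0 i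
  | t_zero => npair 1 0
  | t_one => npair 2 0
  | t_add t u => npair 3 (npair (code_term t) (code_term u))
  | t_mul t u => npair 4 (npair (code_term t) (code_term u))
  end.

Fixpoint code_formula (f : formula) : nat :=
  match f with
  | f_eq t u => npair 0 (npair (code_term t) (code_term u))
  | f_lt t u => npair 1 (npair (code_term t) (code_term u))
  | f_in t i => npair 2 (npair (code_term t) i)
  | f_not f => npair 3 (code_formula f)
  | f_and f g => npair 4 (npair (code_formula f) (code_formula g))
  | f_exN f => npair 5 (code_formula f)
  | f_exS f => npair 6 (code_formula f)
  end.

Lemma code_term_inj : injective code_term.
Proof.
elim=> [i|||t IHt u IHu|t IHt u IHu] [j|||t' u'|t' u'] // /npair_inj[//_].
- by move=> ->.
- by move=> /npair_inj[/IHt -> /IHu ->].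
- by move=> /npair_inj[/IHt -> /IHu ->].
Qed.

Lemma code_formula_inj : injective code_formula.
Proof.
elim=> [t u|t u|t i|f IH|f IHf g IHg|f IH|f IH]
  [t' u'|t' u'|t' i'|f'|f' g'|f'|f'] // /npair_inj[//_].
- by move=> /npair_inj[/code_term_inj -> /code_term_inj ->].
- by move=> /npair_inj[/code_term_inj -> /code_term_inj ->].
- by move=> /npair_inj[/code_term_inj -> ->].
- by move=> /IH ->.
- by move=> /npair_inj[/IHf -> /IHg ->].
- by move=> /IH ->.
- by move=> /IH ->.
Qed.

Definition even_zero : set real := [set x | forall i, ~~ x i.*2].

(** Koenig's diagonal argument.  The odd places are split into countably many
    columns.  A definable class smaller than the continuum cannot show all
    reals in its [n]-th column, so some [y n] is missed by the class of the
    formula with code [n].  The real with columns [y] escapes every such class. *)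
Lemma typical_even_zero : exists2 a, typical a & even_zero a.
Proof.
apply: contrapT => none.
pose column n (x : real) : real := fun m => x (npair n m).*2.+1.
pose small phi := formula_wf 0 1 phi /\ ~ (defined_class phi #= [set: nat -> bool])%card.
have miss n : exists y : real, forall phi, code_formula phi = n -> small phi ->
    forall x, defined_class phi x -> column n x <> y.
  have [[phi [pn [_ hphi]]]|h] := pselect (exists phi, code_formula phi = n /\ small phi);
    last by exists emptyr => phi pn sphi; case: h; exists phi.
  apply: contrapT => hno; apply: hphi; rewrite card_eq_le card_leT /=.
  apply/pcard_surjP; exists (column n) => y _.
  apply: contrapT => hy; apply: hno; exists y => phi' pn' _ x phix xy.
  apply: hy; exists x => //.
  by rewrite (code_formula_inj (etrans pn (esym pn'))).
have /choice[y hy] := miss.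
pose a : real := fun k => if odd k
  then `[< exists n m, k = (npair n m).*2.+1 /\ y n m >] else false.
have az : even_zero a by move=> i; rewrite /a odd_double.
have aty n : column n a = y n.
  apply/funext => m; rewrite /column /a /= odd_double /=.
  apply/asboolP/idP => [[n' [m' [[] /double_inj/npair_inj[-> ->]]]]//|ynm].
  by exists n, m.
have : ~ typical a by move=> ta; apply: none; exists a.
apply=> phi wf pa; apply: contrapT => np.
exact: (hy (code_formula phi) phi erefl (conj wf np) a pa (aty _)).
Qed.

(** * Betting on the even places *)

(** The capital after [s] when all of it is staked on 0 at every even place and
    nothing is staked at the odd places. *)
Definition bet (s : seq bool) : nat :=
  if all (fun i => odd i || ~~ nth false s i) (iota 0 (size s))
  then 2 ^ uphalf (size s) else 0.

Lemma bet_rcons s b : bet (rcons s b) =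
  if odd (size s) then bet s else if b then 0 else bet s + bet s.
Proof.
rewrite /bet size_rcons -addn1 iotaD all_cat add0n /= andbT addn1.
rewrite nth_rcons ltnn eqxx.
rewrite (@eq_in_all _ _ (fun i => odd i || ~~ nth false s i)); last first.
  by move=> i; rewrite mem_iota add0n => /= ilt; rewrite nth_rcons ilt.
rewrite /= uphalf_half; case: (odd _) => //=; case: b => //=; case: all => //.
by rewrite addnn expnS mul2n.
Qed.

Lemma computable_bet : exists2 f, forall s, f (strcode s) = bet s &
  forall t, computable t -> computable (fun xs => f (t xs)).
Proof.
have [par parE cpar] : exists2 f, forall s, f (strcode s) = nat_of_bool (odd (size s)) &
    forall t, computable t -> computable (fun xs => f (t xs)).
  apply: (@computable_string_rec _ (fun _ r => 1 - r)) => [s b|t u ht hu].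
    by rewrite size_rcons /=; case: odd.
  by apply: computable_sub => //; exact: computable_cst.
apply: (@computable_string_rec _ (fun k r => if par k == 0 then r else
  if odd k == 0 :> nat then 0 else r + r)) => [s b|t u ht hu].
  rewrite bet_rcons parE size_rcons /= strcode_rcons oddD odd_double /=.
  by case: odd => //; case: b.
by apply: computable_if0; [exact: cpar | | apply: computable_if0;
  [exact: computable_odd | exact: computable_cst | exact: computable_add]].
Qed.

Lemma bet_restrict_ge x l n : 2 ^ n <= bet (restrict x l) ->
  forall i, i < n -> ~~ x i.*2.
Proof.
rewrite /bet size_restrict; case: allP => [h|_]; last by rewrite leqn0 expn_eq0.
rewrite leq_exp2l// => nl i ilt; have il : i.*2 < l by lia.
by have := h i.*2; rewrite mem_iota /= add0n il odd_double nth_restrict//; apply.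
Qed.

Lemma bet_even_zero x l : even_zero x -> bet (restrict x l) = 2 ^ uphalf l.
Proof.
move=> xz; rewrite /bet size_restrict; case: allP => // -[] i.
rewrite mem_iota /= add0n => il; rewrite nth_restrict//.
by case: (boolP (odd i)) => //= /even_halfK <-.
Qed.

(** * Martingales and tests *)

Section martingales.
Context {R : realType}.
Local Open Scope ring_scope.

(** The maximal inequality of Ville, for an open set given by strings on which [d]
    is at least [c]. *)
Lemma ville (d : seq bool -> R) (W : nat -> Prop) (c : R) : martingale d ->
  0 < c -> (forall s, W (strcode s) -> c <= d s) ->
  (coin R (open_of W) <= (d [::] / c)%:E)%E.
Proof.
move=> [d0 dS] c0 cd.
(* The part of the cylinder of [s] reached within [m] more bits, stopping at the
   first string of [W]; fairness of [d] bounds its measure by induction on [m]. *)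
pose C := fix C m s : set cantor := if `[< W (strcode s) >] then cylinder s
  else if m is m'.+1 then C m' (rcons s false) `|` C m' (rcons s true) else set0.
have mC m s : measurable (C m s).
  elim: m s => [|m IH] s /=; case: ifP => _ //; try exact: measurable_cylinder.
  by apply: measurableU; exact: IH.
have hit s : W (strcode s) -> (coin R (cylinder s) <= (d s / c / 2 ^+ size s)%:E)%E.
  move=> /cd cs; rewrite coin_cylinder lee_fin ler_peMl ?invr_ge0 ?exprn_ge0//.
  by rewrite ler_pdivlMr// mul1r.
have bound m s : (coin R (C m s) <= (d s / c / 2 ^+ size s)%:E)%E.
  have pos : (0 <= (d s / c / 2 ^+ size s)%:E)%E.
    by rewrite lee_fin !divr_ge0// ?exprn_ge0// ltW.
  elim: m s pos => [|m IH] s pos /=; case: asboolP => [/hit//|_].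
    by rewrite measure0.
  apply: le_trans (measureU2 _ _ _) _; [exact: mC | exact: mC |].
  have pos' b : (0 <= (d (rcons s b) / c / 2 ^+ size (rcons s b))%:E)%E.
    by rewrite lee_fin !divr_ge0// ?exprn_ge0// ltW.
  apply: le_trans (leeD (IH _ (pos' _)) (IH _ (pos' _))) _.
  rewrite -EFinD lee_fin !size_rcons exprS invfM !mulrA -!mulrDl -dS.
  by rewrite -[2 * _ / c]mulrA [2 * _]mulrC mulfK// pnatr_eq0.
have cover m l s x : cylinder s x -> (size s <= l <= size s + m)%N ->
    W (strcode (restrict x l)) -> C m s x.
  elim: m s => [|m IH] s xs /andP[sl lm] Wl /=; case: asboolP => // nW.
    by apply: nW; rewrite -xs; have -> : size s = l by lia.
  have sl' : (size s < l)%N.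
    rewrite ltn_neqAle sl andbT; apply/eqP => sE.
    by apply: nW; rewrite -xs sE.
  have xb : cylinder (rcons s (x (size s))) x by rewrite cylinder_rcons.
  by case E: (x (size s)) xb => xb; [right|left]; apply: IH => //;
    rewrite size_rcons sl' addSnnS.
apply/(coin_open_of_le _ 0) => L _; apply: le_trans (_ : _ <= coin R (C L [::]))%E _.
  apply: le_measure; rewrite ?inE; [exact: measurable_covered | exact: mC |].
  by move=> x /coveredP[l lL Wl]; apply: cover Wl => //; rewrite add0n.
by have := bound L [::]; rewrite expr0 divr1.
Qed.

(** Two more bits, of which the first is forced and the second free, halve the
    measure. *)
Lemma coin_even_zero n :
  coin R [set x | forall i, (i < n)%N -> ~~ x i.*2] = (2 ^- n)%:E.
Proof.
pose Z n (s : seq bool) : set cantor :=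
  cylinder s `&` [set x | forall i, (i < n)%N -> ~~ x (size s + i.*2)%N].
have ZS m s : Z m.+1 s = Z m (rcons (rcons s false) false) `|`
                         Z m (rcons (rcons s false) true).
  apply/seteqP; split=> x.
    move=> [xs xz]; have x0 := negbTE (xz 0%N isT); rewrite addn0 in x0.
    have sub b : x (size s).+1 = b -> Z m (rcons (rcons s false) b) x.
      move=> xb; split=> [|i im]; first by rewrite !cylinder_rcons size_rcons.
      by have := xz i.+1 im; rewrite !size_rcons doubleS !addnS.
    by case E: (x (size s).+1); [right|left]; exact: sub.
  have sub b : Z m (rcons (rcons s false) b) x -> Z m.+1 s x.
    rewrite /Z !cylinder_rcons !size_rcons => -[[[xs /= x0] _] xz]; split=> //.
    move=> [_|i im] /=; first by rewrite addn0 x0.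
    by have := xz i im; rewrite doubleS !addnS !addSn.
  by move=> [|]; exact: sub.
have ZP m : forall s, measurable (Z m s) /\ coin R (Z m s) = (2 ^- (size s + m))%:E.
  elim: m => [|m IH] s.
    have -> : Z 0%N s = cylinder s by apply/seteqP; split=> [x []|x xs].
    by rewrite addn0; split; [exact: measurable_cylinder | exact: coin_cylinder].
  rewrite ZS; have [m0 c0] := IH (rcons (rcons s false) false).
  have [m1 c1] := IH (rcons (rcons s false) true).
  split; first exact: measurableU.
  transitivity (coin R (Z m (rcons (rcons s false) false)) +
                coin R (Z m (rcons (rcons s false) true)))%E.
    apply: measureU => //; rewrite -subset0 => x [[+ _] [+ _]].
    by rewrite !cylinder_rcons => -[_ /= ->] [_ /=].
  rewrite c0 c1 !size_rcons -EFinD !addSn addnS !exprS !invfM; congr EFin; lra.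
have := (ZP n [::]).2; rewrite add0n => <-; congr (coin R _).
by apply/seteqP; split=> x; [move=> h; split | case].
Qed.

(** The capital doubles at every even place that holds 0, so it reaches [2 ^ n] iff
    the first [n] even places hold 0. *)
Definition bet_test (n : nat) : set real :=
  [set x | exists l, (2 ^ n <= bet (restrict x l))%N].

Lemma bet_test_schnorr : schnorr_test R bet_test.
Proof.
have E n : bet_test n = [set x | forall i, (i < n)%N -> ~~ x i.*2].
  apply/seteqP; split=> x; first by move=> [l /bet_restrict_ge].
  move=> xz; exists n.*2; rewrite /bet size_restrict; case: allP => [_|[] i].
    by rewrite uphalf_double.
  rewrite mem_iota add0n /= => ilt; rewrite nth_restrict//.
  case: (boolP (odd i)) => //= /even_halfK ik; rewrite -ik; apply: xz; lia.
split; first split.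
- have [f fE cf] := computable_bet.
  exists (fun n k => 2 ^ n - f k = 0)%N.
    apply: re2_eq0; apply: computable_sub; last by apply: cf; exact: computable_nth.
    by apply: computable_exp2; exact: computable_nth.
  move=> n; apply/seteqP; split=> x.
    move=> [l xl]; exists (restrict x l); last by rewrite /cylinder /= size_restrict.
    by rewrite /= fE; apply/eqP.
  by move=> [s /= /eqP]; rewrite fE => sn xs; exists (size s); rewrite [restrict _ _]xs.
- by move=> n; rewrite E coin_even_zero.
- exists id; split=> //; first by exists (r_proj 0).
  by move=> n; rewrite E coin_even_zero.
Qed.

Lemma martingale_bet : martingale (fun s => (bet s)%:R : R).
Proof.
split=> s //; rewrite -!natrD !bet_rcons -natrM.
by congr (_ %:R); case: odd; lia.
Qed.

Lemma computable_real_bet : computable_real_fun (fun s => (bet s)%:R : R).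
Proof.
have [f fE cf] := computable_bet.
have [c hc] := cf _ (computable_nth 0).
have [z hz] := computable_cst 0.
exists (fun k _ => f k), (fun _ _ => 0%N), (fun _ _ => 0%N); split.
- by exists c => m n; exact: hc.
- by exists z => m n; exact: hz.
- by exists z => m n; exact: hz.
- by move=> s n /=; rewrite fE subr0 divr1 subrr normr0 invr_ge0 exprn_ge0.
Qed.

Lemma succeeds_unbounded (d : seq bool -> R) a :
  succeeds d a -> forall c : R, exists n, c < d (restrict a n).
Proof.
move=> da c; apply: contrapT => /forallNP dc.
suff : (limn_esup (fun n => (d (restrict a n))%:E) <= c%:E)%E by rewrite da.
apply: (@le_trans _ _ (ereal_sup [set (d (restrict a n))%:E | n in setT])).
  by apply: ereal_inf_lbound; exists setT => //; exact: filterT.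
apply: ge_ereal_sup => _ [n _ <-]; rewrite lee_fin leNgt.
by apply/negP; exact: dc.
Qed.

Lemma unbounded_succeeds (d : seq bool -> R) a :
  (forall c N, exists2 n, (N <= n)%N & c <= d (restrict a n)) -> succeeds d a.
Proof.
move=> h; apply: eq_infty => c; apply: le_ereal_inf_tmp => _ [V [N _ NV] <-].
have [n Nn cn] := h c N; apply: le_ereal_sup_tmp.
by exists (d (restrict a n))%:E; [exists n => //; exact: NV | rewrite lee_fin].
Qed.

Lemma even_zero_not_schnorr a : even_zero a -> ~ schnorr_random R a.
Proof.
move=> az /(_ _ bet_test_schnorr); apply=> n _; exists n.*2.
by rewrite bet_even_zero// uphalf_double.
Qed.

Lemma even_zero_not_computably_random a :
  even_zero a -> ~ computably_random R a.
Proof.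
move=> az /(_ _ martingale_bet computable_real_bet); apply.
apply: unbounded_succeeds => c N.
pose m := maxn N (Num.truncn c).+1; exists m.*2.
  by apply: leq_trans (leq_maxl _ (Num.truncn c).+1) _; rewrite -addnn leq_addr.
rewrite bet_even_zero// uphalf_double.
apply: (@le_trans _ _ m%:R); last by rewrite ler_nat ltnW// ltn_expl.
apply: (@le_trans _ _ (Num.truncn c).+1%:R); last by rewrite ler_nat leq_maxr.
exact/ltW/truncnS_gt.
Qed.

Lemma ml_schnorr_random a : ml_random R a -> schnorr_random R a.
Proof. by move=> aml V [mlV _]; exact: aml. Qed.

(** If [d] succeeds on [a], the sets where the approximation of [d] exceeds
    [2 ^ (n + k0) + 1] form a test that captures [a], where [2 ^ k0] bounds the
    initial capital.  The approximation within 1 is computable and the strict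
    excess over 1 absorbs its error. *)
Lemma ml_computably_random a : ml_random R a -> computably_random R a.
Proof.
move=> aml d dm [p [q [r [[cp hp] [cq hq] [cr hr] dapp]]]] /succeeds_unbounded da.
pose k0 := (Num.truncn (d [::])).+1.
pose W n k := (((2 ^ (n + k0)).+1 * (r k 0).+1 + q k 0).+1 - p k 0 = 0)%N.
have [ap apE] : exists ap : seq bool -> R, forall s, ap s =
    ((p (strcode s) 0%N)%:R - (q (strcode s) 0%N)%:R) / (r (strcode s) 0%N).+1%:R.
  by eexists.
have dap s : d s - 1 <= ap s <= d s + 1.
  have := dapp s 0%N; rewrite /= -apE expr0 invr1 ler_norml => /andP[d1 d2].
  by apply/andP; split; lra.
have WE n s : W n (strcode s) <-> 2 ^+ (n + k0) + 1 < ap s.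
  rewrite apE.
  rewrite ltr_pdivlMr ?ltr0n// ltrBrDr -natrX natr1 -natrM -natrD ltr_nat.
  by rewrite -subn_eq0; split=> /eqP.
have mlW : ml_test R (fun n => open_of (W n)).
  split.
    exists W => //; apply: re2_eq0.
    have at0 f : computable2 f -> computable (fun xs => f (nth 0%N xs 1) 0%N).
      move=> cf; exact: (computable_app2 cf (computable_nth 1) (computable_cst 0)).
    have [c_p c_q c_r] : [/\ computable2 p, computable2 q & computable2 r].
      by split; [exists cp | exists cq | exists cr].
    apply: computable_sub; last exact: at0.
    apply/computable_succ/computable_add; last exact: at0.
    apply: computable_mul; apply: computable_succ; last exact: at0.
    apply/computable_exp2/computable_add; last exact: computable_cst.
    exact: computable_nth.
  move=> n; apply: le_trans (ville dm (c := 2 ^+ (n + k0)) _ _) _.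
  - by rewrite exprn_gt0.
  - by move=> s /WE ws; have /andP[d1 d2] := dap s; lra.
  rewrite lee_fin ler_pdivrMr ?exprn_gt0// exprD mulKf ?expf_neq0 ?pnatr_eq0//.
  apply: (@le_trans _ _ k0%:R); first exact/ltW/truncnS_gt.
  by rewrite -natrX ler_nat ltnW// ltn_expl.
apply: (aml _ mlW) => n _.
have [l dl] := da (2 ^+ (n + k0) + 2).
exists (restrict a l); last by rewrite /cylinder /= size_restrict.
by apply/WE; have /andP[d1 d2] := dap (restrict a l); lra.
Qed.

(** Each Martin-Loef test has a program, of code [e] say; its component of index
    [e + 2] lies inside the universal open set, which the least safe real
    avoids. *)
Lemma exists_nontypical_ml : exists2 a, ml_random R a & ~ typical a.
Proof.
have ne : ~` open_of unsafe_codes !=set0.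
  apply/set0P/eqP => /(congr1 setC); rewrite setCK setC0 => U.
  by have := @coin_unsafe_lt1 R; rewrite U; rewrite probability_setT ltxx.
have [a la] := lex_least_exists ne.
have safeE x : (~` open_of unsafe_codes) x <->
  ~ exists l k, string_path x l k /\ unsafe_codes k by rewrite open_of_path.
have la' : leftmost_safe a.
  by split=> [|y /safeE]; [apply/safeE; exact: la.1 | exact: la.2].
exists a; last first.
  apply: (not_typical_singleton la' _ pred_def_leftmost_safe) => x y [Kx xl] [Ky yl].
  by apply: lex_le_anti; [exact: xl | exact: yl].
move=> V [[W [c hc] VE] muV] aV; apply: la.1.
pose e := code_recfun c.
have eE : prog_codes e = W e.+2.
  apply/funext => k; apply/propext; rewrite hc; split=> -[y ?]; exists y.
    exact: (@eval_sound c [:: e.+2; k]).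
  exact: (@eval_complete c [:: e.+2; k]).
have [s ws xs] : open_of (W e.+2) a by rewrite /open_of -VE; exact: aV.
exists s => //; exists e; rewrite eE; split=> //.
by apply/(@thinP R); rewrite /open_of -VE.
Qed.

End martingales.

Theorem theorem3p9 (R : realType) :
  [/\ incomparable typical (@ml_random R),
      incomparable typical (@schnorr_random R) &
      incomparable typical (@computably_random R)].
Proof.
have [a ta az] := typical_even_zero.
have [b mlb ntb] := @exists_nontypical_ml R.
have aS := @even_zero_not_schnorr R a az.
split; split=> h.
- exact/aS/ml_schnorr_random/h.
- exact/ntb/h.
- exact/aS/h.
- exact/ntb/h/ml_schnorr_random.
- exact: even_zero_not_computably_random az (h _ ta).
- exact/ntb/h/ml_computably_random.
Qed.
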